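(* Let $N\ge 2$ and let $F(q,m)=[F_1(q,m),\dots,F_N(q,m)]^T\in\mathbb{R}^{2N}$ be given by $$F_i(q,m)=\sum_{j=1,\,j\ne i}^{N}\frac{m_im_j(q_j-q_i)}{\|q_j-q_i\|^3}+\frac{U(q)}{I(q)}\,m_i(q_i-c),\qquad i=1,\dots,N,$$ where $U(q)=\sum_{1\le i<j\le N}\frac{m_im_j}{\|q_i-q_j\|}$, $I(q)=\sum_{i=1}^N m_i\|q_i-c\|^2$ and $c=\frac{\sum_{i=1}^N m_iq_i}{\sum_{i=1}^N m_i}$. Let $q_0$ be a central configuration for the mass vector $m_0$ in the sense that $F(q_0,m_0)=0$. Let $$P=\begin{bmatrix} B_1 & 0\\ B_2 & \mathrm{Id}\end{bmatrix}\in\mathbb{R}^{2N\times 2N},$$ where $\begin{bmatrix} B_1\\ B_2\end{bmatrix}$ is a $2N\times 4$ matrix whose columns are two linearly independent translation vectors, the rotation vector $A'(0)q_0$ and the scaling vector $q_0$, $B_1$ is $4\times 4$, $B_2$ is $(2N-4)\times 4$, $\mathrm{Id}$ is the $(2N-4)\times(2N-4)$ identity matrix, and suppose that $P$ is invertible. Then $$P^{-1}\,\mathrm{Jac}(F)|_{(q_0,m_0)}\,P=\begin{bmatrix} 0 & J_1\\ 0 & J_2\end{bmatrix}$$ with $J_2$ a $(2N-4)\times(2N-4)$ matrix.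
   Context: Masses $m=(m_1,\dots,m_N)$ are positive. Positions are $q=(q_1,\dots,q_N)\in\mathbb{R}^{2N}$ with $q_i=(x_i,y_i)^T\in\mathbb{R}^2$, written as a column $(x_1,y_1,\dots,x_N,y_N)^T$, and configurations are collision-free ($q_i\neq q_j$ for $i\ne j$). $\|\cdot\|$ is the Euclidean norm. $\mathrm{Jac}(F)|_{(q_0,m_0)}$ is the $2N\times 2N$ Jacobian matrix of $F$ with respect to $q$ (with $U$, $I$, $c$ regarded as functions of $q$), evaluated at $(q_0,m_0)$. Let $A(t)=\begin{bmatrix}\cos t&-\sin t\\ \sin t&\cos t\end{bmatrix}$ act diagonally on $\mathbb{R}^{2N}$ by $A(t)q=(A(t)q_1,\dots,A(t)q_N)$; thus, for $q_0=(x_{1},y_{1},\dots,x_{N},y_{N})^T$, $A'(0)q_0=(-y_{1},x_{1},\dots,-y_{N},x_{N})^T$. A translation vector is a vector of the form $(v_x,v_y,v_x,v_y,\dots,v_x,v_y)^T\in\mathbb{R}^{2N}$. A typical choice of the four columns is $(1,0,1,0,\dots,1,0)^T$, $(0,1,0,1,\dots,0,1)^T$, $A'(0)q_0$, $q_0$, so that the rows $2i-1$ and $2i$ of $\begin{bmatrix} B_1\\ B_2\end{bmatrix}$ are $(1,0,-y_i,x_i)$ and $(0,1,x_i,y_i)$. *)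

(* Defs.v *)
From HB Require Import structures.
From mathcomp Require Import all_boot all_order all_algebra.
From mathcomp Require Import all_classical all_reals all_analysis.

Set Implicit Arguments.
Unset Strict Implicit.
Unset Printing Implicit Defensive.

Import Order.TTheory GRing.Theory Num.Theory.
Import numFieldNormedType.Exports.
Local Open Scope ring_scope.

(* Indices are 0-based: the coordinates (x_i, y_i) of the body i occupy the
   rows 2i and 2i+1 of the column (x_0, y_0, x_1, y_1, ...). *)

Lemma coord_subproof N (i : 'I_N) (k : 'I_2) : (2 * i + k < 2 * N)%N.
Proof.
have: (2 * i.+1 <= 2 * N)%N by rewrite leq_pmul2l.
by apply: leq_trans; rewrite mulnS addnC ltn_add2r.
Qed.

Definition coord N (i : 'I_N) (k : 'I_2) : 'I_(2 * N) :=
  Ordinal (coord_subproof i k).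

Lemma particle_subproof N (r : 'I_(2 * N)) : (r %/ 2 < N)%N.
Proof. by rewrite ltn_divLR // [(N * 2)%N]mulnC. Qed.

Definition particle N (r : 'I_(2 * N)) : 'I_N := Ordinal (particle_subproof r).

Definition axis N (r : 'I_(2 * N)) : 'I_2 := Ordinal (ltn_pmod r (isT : (0 < 2)%N)).

Section Configurations.
Context {R : realType} {N : nat}.
Implicit Types (q : 'cV[R]_(2 * N)) (m : 'I_N -> R).

Definition body q (i : 'I_N) : 'cV[R]_2 := \col_(k < 2) q (coord i k) 0.

Definition stack (f : 'I_N -> 'cV[R]_2) : 'cV[R]_(2 * N) :=
  \col_(r < 2 * N) f (particle r) (axis r) 0.

Lemma stackK f : body (stack f) =1 f.
Proof.
move=> i; apply/colP => k; rewrite !mxE.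
have -> : particle (coord i k) = i.
  by apply: val_inj; rewrite /= mulnC divnMDl // divn_small ?addn0.
suff -> : axis (coord i k) = k by [].
by apply: val_inj; rewrite /= mulnC modnMDl modn_small.
Qed.

Lemma bodyK q : stack (body q) = q.
Proof.
apply/colP => r; rewrite !mxE; congr (q _ _).
by apply: val_inj; rewrite /= mulnC -divn_eq.
Qed.

(* The library norm `|v| on matrices is the sup norm. *)
Definition enorm n (v : 'cV[R]_n) : R := Num.sqrt (\sum_(k < n) v k 0 ^+ 2).

Definition collision_free q : Prop :=
  forall i j : 'I_N, i != j -> body q i != body q j.

Definition center m q : 'cV[R]_2 :=
  (\sum_(i < N) m i)^-1 *: \sum_(i < N) m i *: body q i.

Definition potential m q : R :=
  \sum_(i < N) \sum_(j < N | (i < j)%N) m i * m j / enorm (body q i - body q j).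

Definition inertia m q : R :=
  \sum_(i < N) m i * enorm (body q i - center m q) ^+ 2.

Definition cc_force q m (i : 'I_N) : 'cV[R]_2 :=
  \sum_(j < N | j != i)
     (m i * m j / enorm (body q j - body q i) ^+ 3) *: (body q j - body q i)
  + (potential m q / inertia m q * m i) *: (body q i - center m q).

Definition cc_map q m : 'cV[R]_(2 * N) := stack (cc_force q m).

Definition central_configuration q m : Prop :=
  cc_map q m = 0.

(* The library's jacobian is the transposed matrix, for row vectors. *)
Definition Jac n p (f : 'cV[R]_n -> 'cV[R]_p) (x : 'cV[R]_n) : 'M[R]_(p, n) :=
  \matrix_(i < p, j < n) 'D_(delta_mx j 0) (fun y : 'cV[R]_n => f y i 0) x.

Definition rotation (t : R) : 'M[R]_2 :=
  \matrix_(i < 2, j < 2)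
    (nth [::] [:: [:: cos t; - sin t];
                  [:: sin t;   cos t]] i)`_j.

Definition diag_act (A : 'M[R]_2) q : 'cV[R]_(2 * N) :=
  stack (fun i => A *m body q i).

Definition rotation_vector q : 'cV[R]_(2 * N) :=
  diag_act (derive1 rotation 0) q.

Lemma rotation_vectorE q (i : 'I_N) :
  body (rotation_vector q) i =
  \col_k (if k == 0 then - body q i 1 0 else body q i 0 0).
Proof.
have dR (j k : 'I_2) : is_derive (0 : R) 1 (fun t => rotation t j k)
    (nth [::] [:: [:: 0; -1]; [:: 1; 0]] j)`_k.
  have -> : (fun t : R => rotation t j k) = (fun t =>
    (nth [::] [:: [:: cos t; - sin t]; [:: sin t; cos t]] j)`_k).
    by apply/funext => t; rewrite mxE.
  have hs := is_derive_sin (0 : R); have hc := is_derive_cos (0 : R).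
  rewrite sin0 oppr0 in hc; rewrite cos0 in hs.
  have hn := is_deriveN hs.
  case: j => -[|[|//]] ? /=; case: k => -[|[|//]] ? /=; done.
rewrite stackK derive1E derive_mx; last first.
  by apply/derivable_mxP => j k; case: (dR j k).
apply/colP => k; rewrite !mxE big_ord_recl big_ord1 !mxE.
rewrite !(derive_val (is_derive := dR _ _)).
case: k => -[|[|//]] ? /=; rewrite ?mul0r ?mul1r ?mulN1r ?add0r ?addr0 //; do ?congr (- _); congr (q _ _); exact: val_inj.
Qed.

Definition is_translation_vector (w : 'cV[R]_(2 * N)) : Prop :=
  exists v : 'cV[R]_2, w = stack (fun=> v).

Lemma dim_split (hN : (2 <= N)%N) : (4 + (2 * N - 4) = 2 * N)%N.
Proof. by rewrite subnKC // (leq_pmul2l (m := 2) (n1 := 2)). Qed.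

Definition col4_mx (hN : (2 <= N)%N) (B1 : 'M[R]_4) (B2 : 'M[R]_(2 * N - 4, 4)) :
    'M[R]_(2 * N, 4) :=
  castmx (dim_split hN, erefl) (col_mx B1 B2).

Definition block4_mx (hN : (2 <= N)%N)
    (Aul : 'M[R]_4) (Aur : 'M[R]_(4, 2 * N - 4))
    (Adl : 'M[R]_(2 * N - 4, 4)) (Adr : 'M[R]_(2 * N - 4)) : 'M[R]_(2 * N) :=
  castmx (dim_split hN, dim_split hN) (block_mx Aul Aur Adl Adr).

End Configurations.

(* Main.v *)
(* The first four columns of [P] are those of [B], so it suffices that the
   Jacobian kills each of them. Translating [q] does not change [F], and
   [F (A q) = s ^- 3 *: A (F q)] when [A] multiplies all norms by [s]. Hence [F]
   is constant along the lines through [q0] directed by the translation vectors,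
   [q0] and [A'(0) q0]: along the last two, the points are images of [q0] under
   similarities, and [F q0 = 0]. Since [F] is differentiable at a collision-free
   configuration, the Jacobian vanishes in these four directions. *)
Require Import Defs.
From mathcomp Require Import all_boot all_order all_algebra.
From mathcomp Require Import all_classical all_reals all_analysis.
From mathcomp Require Import ring.

Set Implicit Arguments.
Unset Strict Implicit.
Unset Printing Implicit Defensive.

Import Order.TTheory GRing.Theory Num.Theory.
Import numFieldNormedType.Exports.
Local Open Scope ring_scope.

(** * Differentiability of finite sums, powers and the Euclidean norm *)

Lemma differentiable_sum_seq (R : realType) (V W : normedModType R) (I : Type)
    (r : seq I) (p : pred I) (f : I -> V -> W) (x : V) :
  (forall i, p i -> differentiable (f i) x) ->
  differentiable (fun y => \sum_(i <- r | p i) f i y) x.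
Proof.
move=> df; rewrite -fct_sumE; apply: (big_ind (fun g : V -> W => differentiable g x)) => //.
by move=> g h dg dh; apply: differentiableD.
Qed.

Lemma differentiable_expr (R : realType) (V : normedModType R) (f : V -> R)
    (n : nat) (x : V) :
  differentiable f x -> differentiable (fun y => f y ^+ n.+1) x.
Proof. by move=> /(differentiableX n); rewrite exprfctE. Qed.

Section EuclideanNorm.
Context {R : realType}.

Lemma enormE n (v : 'cV[R]_n) : enorm v ^+ 2 = \sum_(k < n) v k 0 ^+ 2.
Proof. by rewrite sqr_sqrtr // sumr_ge0 // => k _; rewrite sqr_ge0. Qed.

Lemma enorm_eq0 n (v : 'cV[R]_n) : (enorm v == 0) = (v == 0).
Proof.
rewrite -sqrf_eq0 enormE psumr_eq0; last by move=> k _; rewrite sqr_ge0.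
apply/allP/eqP => [h|-> k _]; last by rewrite mxE expr0n /= eqxx.
apply/colP => k; rewrite mxE; apply/eqP.
by rewrite -sqrf_eq0; exact: (h k (mem_index_enum k)).
Qed.

(** The square root is differentiable only at positive arguments, whence the condition
    [f x != 0]. *)
Lemma differentiable_enorm (V : normedModType R) n (f : V -> 'cV[R]_n) (x : V) :
  (forall k, differentiable (fun y => f y k 0) x) -> f x != 0 ->
  differentiable (fun y => enorm (f y)) x.
Proof.
move=> df fx0.
have dsq : differentiable (fun y => \sum_(k < n) f y k 0 ^+ 2) x.
  by apply: differentiable_sum_seq => k _; apply: differentiable_expr.
apply: (differentiable_comp dsq); apply/derivable1_diffP.
have pos : 0 < \sum_(k < n) f x k 0 ^+ 2.
  by rewrite -enormE exprn_even_gt0 //= enorm_eq0.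
by case: (is_derive1_sqrt pos).
Qed.

End EuclideanNorm.

(** * The Jacobian and directional derivatives *)

Section DirectionalJacobian.
Context {R : realType} {n p : nat}.
Implicit Types (f : 'cV[R]_n -> 'cV[R]_p) (x v : 'cV[R]_n).

(** [Jac] collects partial derivatives only; differentiability makes the derivative linear in the
    direction, so [v] can be expanded in the standard basis. *)
Lemma mulmx_JacE f x v i : differentiable (fun y => f y i 0) x ->
  (Jac f x *m v) i 0 = 'D_v (fun y => f y i 0) x.
Proof.
move=> df; rewrite deriveE // [in RHS](matrix_sum_delta v).
rewrite linear_sum /= mxE; apply: eq_bigr => j _.
by rewrite big_ord1 linearZ /= mxE deriveE // mulrC.
Qed.

Lemma Jac_ker f x v :
  (forall i, differentiable (fun y => f y i 0) x) ->
  (forall t : R, f (x + t *: v) = f x) -> Jac f x *m v = 0.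
Proof.
move=> df fv; apply/colP => i; rewrite mulmx_JacE // mxE.
(* Zero is written as the derivative of a constant map, whose difference quotients agree with those
   of [f] along the line. *)
rewrite -[RHS](derive_cst (f x i 0) x v) /derive.
by under eq_fun => h do rewrite /= [h *: v + x]addrC fv.
Qed.

End DirectionalJacobian.

Section CentralConfigurations.
Context {R : realType} {N : nat}.
Implicit Types (q : 'cV[R]_(2 * N)) (m : 'I_N -> R).

(** * Behaviour of the force map under translations and similarities *)

Lemma body_inj q q' : body q =1 body q' -> q = q'.
Proof.
by move=> e; rewrite -(bodyK q) -(bodyK q'); congr stack; apply/funext.
Qed.

Lemma bodyD q q' i : body (q + q') i = body q i + body q' i.
Proof. by apply/colP => k; rewrite !mxE. Qed.

Lemma bodyZ t q i : body (t *: q) i = t *: body q i.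
Proof. by apply/colP => k; rewrite !mxE. Qed.

(** The centre of mass moves along with the bodies, and the force depends only on differences of
    positions. *)
Lemma cc_map_translation q m (v : 'cV[R]_2) : \sum_i m i != 0 ->
  cc_map (q + stack (fun=> v)) m = cc_map q m.
Proof.
move=> m0; have bE i : body (q + stack (fun=> v)) i = body q i + v.
  by rewrite bodyD stackK.
have sub (a b : 'cV[R]_2) : a + v - (b + v) = a - b.
  by rewrite opprD addrACA subrr addr0.
have cE : Defs.center m (q + stack (fun=> v)) = Defs.center m q + v.
  rewrite /Defs.center (eq_bigr (fun i => m i *: body q i + m i *: v)); last first.
    by move=> i _; rewrite bE scalerDr.
  by rewrite big_split /= -scaler_suml scalerDr scalerA mulVf // scale1r.
have UE : potential m (q + stack (fun=> v)) = potential m q.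
  by apply: eq_bigr => i _; apply: eq_bigr => j _; rewrite !bE sub.
have IE : inertia m (q + stack (fun=> v)) = inertia m q.
  by apply: eq_bigr => i _; rewrite bE cE sub.
congr stack; apply/funext => i; rewrite /cc_force UE IE cE bE sub.
by congr (_ + _); apply: eq_bigr => j _; rewrite bE sub.
Qed.

(** The potential scales by [s^-1] and the inertia by [s ^+ 2], so their quotient scales by
    [s ^- 3], exactly as the coefficients of the pair forces do. The convention [0^-1 = 0] covers
    [s = 0]. *)
Lemma cc_map_similarity q m (A : 'M[R]_2) (s : R) :
  (forall v, enorm (A *m v) = s * enorm v) ->
  cc_map (diag_act A q) m = s ^- 3 *: diag_act A (cc_map q m).
Proof.
move=> hA; have bE i : body (diag_act A q) i = A *m body q i by rewrite stackK.
have cE : Defs.center m (diag_act A q) = A *m Defs.center m q.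
  rewrite /Defs.center -scalemxAr mulmx_sumr; congr (_ *: _).
  by apply: eq_bigr => i _; rewrite bE scalemxAr.
have UE : potential m (diag_act A q) = s^-1 * potential m q.
  rewrite /potential mulr_sumr; apply: eq_bigr => i _.
  rewrite mulr_sumr; apply: eq_bigr => j _.
  by rewrite !bE -mulmxBr hA invfM mulrCA.
have IE : inertia m (diag_act A q) = s ^+ 2 * inertia m q.
  rewrite /inertia mulr_sumr; apply: eq_bigr => i _.
  by rewrite bE cE -mulmxBr hA exprMn mulrCA.
apply: body_inj => i; rewrite bodyZ !stackK /cc_force UE IE bE cE.
rewrite mulmxDr [RHS]scalerDr; congr (_ + _).
  rewrite mulmx_sumr scaler_sumr; apply: eq_bigr => j _.
  by rewrite !bE -!mulmxBr hA exprMn invfM -scalemxAr scalerA mulrCA.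
rewrite -mulmxBr -scalemxAr scalerA; congr (_ *: _).
by rewrite invfM mulrACA -invfM -exprS [RHS]mulrA.
Qed.

(** * Differentiability of the force map at collision-free configurations *)

Lemma differentiable_body q i k : differentiable (fun y => body y i k 0) q.
Proof.
by under eq_fun do rewrite mxE; exact: differentiable_coord.
Qed.

Lemma differentiable_bodyB q i j k :
  differentiable (fun y => (body y i - body y j) k 0) q.
Proof.
under eq_fun do rewrite mxE [X in _ + X]mxE.
by apply: differentiableB; exact: differentiable_body.
Qed.

Lemma differentiable_center q m k : differentiable (fun y => Defs.center m y k 0) q.
Proof.
under eq_fun do rewrite mxE summxE.
apply: (differentiableZ (\sum_i m i)^-1); apply: differentiable_sum_seq => i _.
under eq_fun do rewrite mxE.
by apply: (differentiableZ (m i)); exact: differentiable_body.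
Qed.

Lemma differentiable_body_center q m i k :
  differentiable (fun y => (body y i - Defs.center m y) k 0) q.
Proof.
under eq_fun do rewrite mxE [X in _ + X]mxE.
by apply: differentiableB; [exact: differentiable_body|exact: differentiable_center].
Qed.

Lemma differentiable_inertia q m : differentiable (inertia m) q.
Proof.
(* Squaring removes the root, so a body located at the centre of mass is harmless. *)
apply: differentiable_sum_seq => i _; under eq_fun do rewrite enormE.
apply: (differentiableZ (m i)); apply: differentiable_sum_seq => k _.
by apply: differentiable_expr; exact: differentiable_body_center.
Qed.

Lemma differentiable_div_enorm_body q i j (a : R) n :
  body q i != body q j ->
  differentiable (fun y => a / enorm (body y i - body y j) ^+ n.+1) q.
Proof.
move=> qij; apply: (differentiableZ a); apply: differentiableV.
  apply: differentiable_expr; apply: differentiable_enorm; last by rewrite subr_eq0.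
  exact: differentiable_bodyB.
by rewrite expf_neq0 // enorm_eq0 subr_eq0.
Qed.

Lemma differentiable_potential q m : collision_free q ->
  differentiable (potential m) q.
Proof.
move=> hq; apply: differentiable_sum_seq => i _.
apply: differentiable_sum_seq => j ij.
by apply: (@differentiable_div_enorm_body _ _ _ _ 0); apply: hq; rewrite neq_ltn ij.
Qed.

(** If the inertia vanished, all bodies would sit at the centre of mass, yet there are at least two
    and they are distinct. *)
Lemma inertia_neq0 q m : (2 <= N)%N -> (forall i, 0 < m i) ->
  collision_free q -> inertia m q != 0.
Proof.
move=> hN hm hq; apply/negP; rewrite psumr_eq0; last first.
  by move=> i _; apply: mulr_ge0; [exact: ltW|exact: sqr_ge0].
move=> /allP h.
have bc i : body q i = Defs.center m q.
  have := h i (mem_index_enum _).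
  by rewrite mulf_eq0 gt_eqF //= sqrf_eq0 enorm_eq0 subr_eq0 => /eqP.
have /negP[] := hq (Ordinal (ltnW hN)) (Ordinal hN) isT.
by rewrite !bc.
Qed.

Lemma differentiable_cc_map q m r : (2 <= N)%N -> (forall i, 0 < m i) ->
  collision_free q -> differentiable (fun y => cc_map y m r 0) q.
Proof.
move=> hN hm hq; under eq_fun do rewrite mxE mxE summxE.
apply: differentiableD.
  apply: differentiable_sum_seq => j ji; under eq_fun do rewrite mxE.
  apply: differentiableM; last exact: differentiable_bodyB.
  by apply: differentiable_div_enorm_body; apply: hq.
under eq_fun do rewrite mxE.
apply: differentiableM; last exact: differentiable_body_center.
apply: differentiableM; last exact: differentiable_cst.
apply: differentiableM; first exact: differentiable_potential.
apply: differentiableV; first exact: differentiable_inertia.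
exact: inertia_neq0.
Qed.

(** * The four kernel directions of the Jacobian *)

Lemma Jac_cc_map_translation q m w : (2 <= N)%N -> (forall i, 0 < m i) ->
  collision_free q -> is_translation_vector w ->
  Jac (fun y => cc_map y m) q *m w = 0.
Proof.
move=> hN hm hq [v ->]; apply: Jac_ker => [r|t].
  exact: differentiable_cc_map.
have -> : t *: stack (fun=> v) = stack (fun=> t *: v) :> 'cV[R]_(2 * N).
  by apply/colP => r; rewrite !mxE.
apply: cc_map_translation; rewrite gt_eqF //.
rewrite (bigD1 (Ordinal hN)) //= ltr_pwDl //.
by rewrite sumr_ge0 // => i _; rewrite ltW.
Qed.

(** Common to scaling and rotation: the line from [q] along [diag_act A q] consists of images of [q]
    under [1%:M + t *: A], a similarity of ratio [s t], so the force stays zero along it. *)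
Lemma Jac_cc_map_diag_act q m (A : 'M[R]_2) (s : R -> R) :
  (2 <= N)%N -> (forall i, 0 < m i) -> collision_free q ->
  central_configuration q m ->
  (forall t v, enorm (v + t *: (A *m v)) = s t * enorm v) ->
  Jac (fun y => cc_map y m) q *m diag_act A q = 0.
Proof.
move=> hN hm hq hcc hA; apply: Jac_ker => [r|t].
  exact: differentiable_cc_map.
have -> : q + t *: diag_act A q = diag_act (1%:M + t *: A) q.
  apply: body_inj => i.
  by rewrite bodyD bodyZ !stackK mulmxDl mul1mx scalemxAl.
rewrite (@cc_map_similarity _ _ _ (s t)); last first.
  by move=> v; rewrite mulmxDl mul1mx -scalemxAl hA.
rewrite hcc; apply: body_inj => i; rewrite bodyZ stackK.
have -> : body (0 : 'cV[R]_(2 * N)) i = 0 by apply/colP => k; rewrite !mxE.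
by rewrite mulmx0 scaler0.
Qed.

Lemma Jac_cc_map_scaling q m : (2 <= N)%N -> (forall i, 0 < m i) ->
  collision_free q -> central_configuration q m ->
  Jac (fun y => cc_map y m) q *m q = 0.
Proof.
move=> hN hm hq hcc.
have {2}-> : q = diag_act 1%:M q.
  by apply: body_inj => i; rewrite stackK mul1mx.
(* At [t = -1] the ratio is 0 and all bodies collapse to the origin; the similarity lemma includes
   this case. *)
apply: (Jac_cc_map_diag_act (s := fun t => `|1 + t|)) => // t v.
rewrite mul1mx -{1}[v]scale1r -scalerDl /enorm.
under eq_bigr do rewrite mxE exprMn.
by rewrite -mulr_sumr sqrtrM ?sqr_ge0 // sqrtr_sqr.
Qed.

(* The straight line from [q] along the rotation vector consists of rotated and
   dilated copies of [q]: [1 + t A'(0)] is [sqrt (1 + t ^+ 2)] times a rotation. *)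
Lemma Jac_cc_map_rotation q m : (2 <= N)%N -> (forall i, 0 < m i) ->
  collision_free q -> central_configuration q m ->
  Jac (fun y => cc_map y m) q *m rotation_vector q = 0.
Proof.
move=> hN hm hq hcc.
(* The quarter turn, which is the derivative of [rotation] at 0. *)
pose A : 'M[R]_2 := \matrix_(j, k)
  (if j == 0 then - (k == 1)%:R else (k == 0)%:R).
have AE v : A *m v = \col_k (if k == 0 then - v 1 0 else v 0 0).
  apply/colP => k; rewrite !mxE big_ord_recl big_ord1 !mxE.
  have -> : lift ord0 ord0 = 1 :> 'I_2 by exact: val_inj.
  have -> : ord0 = 0 :> 'I_2 by [].
  by case: ifP => _ /=; rewrite ?oppr0 ?mul0r ?mul1r ?mulN1r ?add0r ?addr0.
have -> : rotation_vector q = diag_act A q.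
  by apply: body_inj => i; rewrite rotation_vectorE stackK AE !mxE.
apply: (Jac_cc_map_diag_act (s := fun t => Num.sqrt (1 + t ^+ 2))) => // t v.
rewrite -sqrtrM; last by rewrite addr_ge0 // sqr_ge0.
(* A vector and its quarter turn are orthogonal, so the cross terms in the squared norm cancel. *)
congr Num.sqrt; rewrite AE !big_ord_recl !big_ord0 !mxE /= !addr0.
have -> : lift ord0 ord0 = 1 :> 'I_2 by exact: val_inj.
ring.
Qed.

End CentralConfigurations.

(** * Block form of the conjugated Jacobian *)

(** The first [a] columns of the product are [Q] applied to [J *m B = 0], where [B] stacks [B1] on
    [B2]. The size [n] is a variable so that eliminating [e] removes the casts. *)
Lemma block_conj_ker (R : realType) (a b n : nat) (e : (a + b = n)%N)
    (B1 : 'M[R]_a) (B2 : 'M[R]_(b, a)) (J Q : 'M[R]_n) :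
  J *m castmx (e, erefl a) (col_mx B1 B2) = 0 ->
  exists (J1 : 'M[R]_(a, b)) (J2 : 'M[R]_b),
    Q *m J *m castmx (e, e) (block_mx B1 0 B2 1%:M) =
    castmx (e, e) (block_mx 0 J1 0 J2).
Proof.
case: n / e J Q => J Q; rewrite !castmx_id => JB.
(* The remaining [b] columns of the product, cut into their top and bottom blocks. *)
pose Y := Q *m J *m col_mx 0 1%:M; exists (usubmx Y), (dsubmx Y).
by rewrite block_mxEh mul_mx_row -mulmxA JB mulmx0 block_mxEh vsubmxK col_mx0.
Qed.

Theorem proposition3p14 (R : realType) (N : nat) (hN : (2 <= N)%N)
    (m0 : 'I_N -> R) (q0 : 'cV[R]_(2 * N))
    (B1 : 'M[R]_4) (B2 : 'M[R]_(2 * N - 4, 4))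
    (B : 'M[R]_(2 * N, 4)) (P : 'M[R]_(2 * N))
    (hm0 : forall i, 0 < m0 i)
    (hcol : collision_free q0)
    (hq0 : central_configuration q0 m0)
    (hB : B = col4_mx hN B1 B2)
    (hB0 : is_translation_vector (col 0 B))
    (hB1 : is_translation_vector (col 1 B))
    (hB01 : free [:: col 0 B; col 1 B])
    (hB2 : col 2 B = rotation_vector q0)
    (hB3 : col 3 B = q0)
    (hP : P = block4_mx hN B1 0 B2 1%:M)
    (hPunit : P \in unitmx) :
  exists (J1 : 'M[R]_(4, 2 * N - 4)) (J2 : 'M[R]_(2 * N - 4)),
    invmx P *m Jac (fun q => cc_map q m0) q0 *m P = block4_mx hN 0 J1 0 J2.
Proof.
rewrite [X in _ *m X]hP; apply: block_conj_ker.
rewrite -[castmx _ _]/(col4_mx hN B1 B2) -hB.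
set J := Jac _ _.
have J0 : J *m col 0 B = 0 by exact: Jac_cc_map_translation.
have J1 : J *m col 1 B = 0 by exact: Jac_cc_map_translation.
have J2 : J *m col 2 B = 0 by rewrite hB2; exact: Jac_cc_map_rotation.
have J3 : J *m col 3 B = 0 by rewrite hB3; exact: Jac_cc_map_scaling.
(* The product [J *m B] is treated column by column, each column being one of the four kernel
   vectors. *)
apply/matrixP => i k; transitivity ((J *m col k B) i 0).
  by rewrite !mxE; apply: eq_bigr => j _; rewrite !mxE.
suff -> : J *m col k B = 0 by rewrite !mxE.
by case: k => -[|[|[|[|//]]]] hk;
  [rewrite -J0|rewrite -J1|rewrite -J2|rewrite -J3]; congr (_ *m col _ _); exact: val_inj.
Qed.
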